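(* Let $k\ge 2$ and $r$ be integers with $1\le r\le k$, and let $S(r,k)=\sum_{n=1}^{k}|\mathcal{P}_n(r,k)|$. Then $$S(r,k)=\frac{1}{k}\sum_{s\mid (k,r)}\binom{k/s}{r/s}\varphi(s),$$ where the sum is taken over all positive divisors $s$ of the greatest common divisor $(k,r)$ of $k$ and $r$.
   Context: For a finite set $A$ of nonnegative integers and a positive integer $i$, let $\overline{A}(i)\subseteq\{0,1,\ldots,i-1\}$ be the set of residues modulo $i$ of the elements of $A$; two finite sets $A,B$ are called equal modulo $i$ if $\overline{A}(i)=\overline{B}(i)$. Write $A+t=\{a+t: a\in A\}$. For integers $1\le j\le i$, $\mathcal{A}(j,i)$ denotes the collection of all subsets of $\{0,1,\ldots,i-1\}$ with exactly $j$ elements. For $A\in\mathcal{A}(j,i)$, $f_i(A)$ denotes the smallest positive integer $l$ such that $A$ equals $A+l$ modulo $i$ (it exists and is at most $i$). For $1\le s\le i$, $\mathcal{A}_s(j,i)=\{A\in\mathcal{A}(j,i): f_i(A)=s\}$. For $1\le n\le k$, two sets $A,A'\in\mathcal{A}_n(r,k)$ are called $k$-equivalent if there exists $j\in\{0,1,\ldots,k-1\}$ such that $A+j$ equals $A'$ modulo $k$; this is an equivalence relation, and $\mathcal{P}_n(r,k)$ denotes the set of its equivalence classes in $\mathcal{A}_n(r,k)$ (empty if $\mathcal{A}_n(r,k)$ is empty). $(x,y)$ denotes the greatest common divisor, $|\cdot|$ cardinality, and $\varphi$ the Euler totient function. *)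

(* Defs.v *)
From mathcomp Require Import all_boot all_order all_algebra.
From mathcomp Require Import finmap.

Set Implicit Arguments.
Unset Strict Implicit.
Unset Printing Implicit Defensive.

Local Open Scope fset_scope.
Local Open Scope nat_scope.

Definition residues (i : nat) (A : {fset nat}) : {set 'I_i} :=
  [set x : 'I_i | nat_of_ord x \in [fset a %% i | a in A]].

Definition eqmod (i : nat) (A B : {fset nat}) : bool :=
  residues i A == residues i B.

Definition shift (A : {fset nat}) (t : nat) : {fset nat} :=
  [fset a + t | a in A].

(* Subsets of {0, ..., i-1} are taken in {set 'I_i}; since A + t leaves that
   range, they are turned into finite sets of natural numbers before being
   translated. *)
Definition natset (i : nat) (A : {set 'I_i}) : {fset nat} :=
  [fset nat_of_ord x | x in A].

Definition subsets (j i : nat) : {set {set 'I_i}} :=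
  [set A : {set 'I_i} | #|A| == j].

Lemma period_exists (i : nat) (A : {fset nat}) :
  exists l, (0 < l) && eqmod i A (shift A l).
Proof.
case: i => [|i]; first by exists 1; apply/eqP/setP => -[].
exists i.+1; apply/eqP/setP => x; rewrite !inE.
apply/imfsetP/imfsetP => -[a /= aA ->].
  by exists (a + i.+1); rewrite ?modnDr //; apply: in_imfset.
by have /imfsetP[b /= bA ->] := aA; exists b; rewrite ?modnDr.
Qed.

Definition period (i : nat) (A : {set 'I_i}) : nat :=
  ex_minn (period_exists i (natset A)).

Definition subsets_of_period (s j i : nat) : {set {set 'I_i}} :=
  [set A in subsets j i | period A == s].

Definition kequiv (k : nat) : rel {set 'I_k} :=
  fun A A' => [exists j : 'I_k, eqmod k (shift (natset A) j) (natset A')].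

Definition classes_of_period (n r k : nat) : {set {set {set 'I_k}}} :=
  equivalence_partition (@kequiv k) (subsets_of_period n r k).

Definition total_classes (r k : nat) : nat :=
  \sum_(1 <= n < k.+1) #|classes_of_period n r k|.

(* Main.v *)
Require Import Defs.
From mathcomp Require Import all_boot all_order all_algebra.
From mathcomp Require Import all_fingroup all_solvable finmap.

(* Translation makes Z/k act on the r-subsets of Z/k; the period is constant on
   orbits, so the classes of all periods together are the orbits of this action.
   Burnside's lemma counts them: a translation of additive order d fixes exactly
   the unions of cosets of a subgroup of order d, of which there are
   'C(k / d, r / d) with r elements if d divides r and none otherwise, and Z/k
   has phi(d) elements of order d for each divisor d of k. *)

Set Implicit Arguments.
Unset Strict Implicit.
Unset Printing Implicit Defensive.

Local Open Scope nat_scope.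

Lemma sum_partition_seq (I : finType) (J : eqType) (s : seq J) (A : {pred I})
    (h : I -> J) (F : I -> nat) :
    uniq s -> {in A, forall i, h i \in s} ->
  \sum_(i in A) F i = \sum_(j <- s) \sum_(i in A | h i == j) F i.
Proof.
move=> Us hs; under [RHS]eq_bigr => j _ do rewrite big_mkcondr.
rewrite exchange_big; apply: eq_bigr => i Ai /=.
rewrite (bigD1_seq (h i)) ?hs //= eqxx big1 ?addn0 // => j.
by rewrite eq_sym => /negbTE->.
Qed.

(** A block of [P] inside [cover Q] is nonempty, so it meets a block of [Q] and equals it by
    disjointness. Hence [cover] is injective on subfamilies of [P]. *)
Lemma setI_cover_subset (T : finType) (P Q : {set {set T}}) :
  trivIset P -> set0 \notin P -> Q \subset P -> P ::&: cover Q = Q.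
Proof.
move=> tiP P0 /subsetP sQP; apply/setP => B; rewrite !inE.
apply/andP/idP => [[PB sBQ]|QB]; last by rewrite sQP ?(bigcup_sup B).
have [x Bx]: exists x, x \in B by apply/set0Pn; apply: contraNneq P0 => <-.
have /bigcupP[C QC Cx] := subsetP sBQ x Bx.
by rewrite -(def_pblock tiP PB Bx) (def_pblock tiP (sQP C QC) Cx).
Qed.

(** A union of blocks determines its blocks and has [n] elements for each of them, so only choices
    of exactly [r / n] blocks contribute. *)
Lemma card_cover_draws (T : finType) (D : {set T}) (P : {set {set T}}) (n r : nat) :
    0 < n -> partition P D -> {in P, forall B : {set T}, #|B| = n} ->
  #|[set A in cover @: powerset P | #|A| == r]| =
    if n %| r then 'C(#|P|, r %/ n) else 0.
Proof.
move=> n_gt0 /and3P[_ tiP P0] unifP.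
have cardQ (Q : {set {set T}}) : Q \subset P -> #|cover Q| = #|Q| * n.
  move=> sQP; apply: card_uniform_partition => [B /(subsetP sQP)/unifP //|].
  by rewrite /partition eqxx (trivIsetS sQP) //=; apply: contra P0 => /(subsetP sQP).
case: ifP => [/dvdnP[m ->]|ndv].
  rewrite mulnK // -cards_draws -(card_in_imset (f := @cover T)); last first.
    move=> Q R; rewrite !inE => /andP[sQ _] /andP[sR _] eqQR.
    by rewrite -(setI_cover_subset tiP P0 sQ) eqQR setI_cover_subset.
  apply: eq_card => A; rewrite inE; apply/andP/imsetP.
    case=> /imsetP[Q]; rewrite powersetE => sQ ->; rewrite cardQ // eqn_pmul2r // => mQ.
    by exists Q; rewrite // inE sQ.
  case=> Q; rewrite inE => /andP[sQ /eqP mQ] ->.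
  by rewrite cardQ // mQ imset_f ?powersetE.
apply: eq_card0 => A; rewrite !inE; apply/andP => -[/imsetP[Q]].
by rewrite powersetE => sQ -> /eqP; rewrite cardQ // => rE; rewrite -rE dvdn_mull in ndv.
Qed.

Import GroupScope.

(** Invariance under [a] passes to all its powers, so an invariant set contains the whole coset [x
    *: <[a]>] of each of its points; these cosets are the orbits of right translation by [<[a]>]. *)
Lemma rcoset_fix_cover (gT : finGroupType) (a : gT) :
  [set A : {set gT} | A :* a == A] = cover @: powerset (orbit 'R <[a]> @: [set: gT]).
Proof.
apply/setP => A; rewrite inE; apply/eqP/imsetP => [fixA|[Q]].
  have fixX n : A :* (a ^+ n) = A.
    by elim: n => [|n IHn]; rewrite ?rcoset1 // expgSr rcosetM IHn.
  exists [set x *: <[a]> | x in A].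
    rewrite powersetE; apply/subsetP => _ /imsetP[x _ ->].
    by rewrite -orbitR imset_f.
  apply/setP => x; rewrite cover_imset; apply/idP/bigcupP => [Ax|[y Ay]].
    by exists x; rewrite ?lcoset_refl.
  by case/lcosetP => _ /cycleP[n ->] ->; rewrite -(fixX n) mem_rcoset mulgK.
(* Translation preserves cardinality, so one inclusion suffices. *)
rewrite powersetE => /subsetP sQ ->; apply/eqP; rewrite eqEcard card_rcoset leqnn andbT.
apply/subsetP => _ /rcosetP[x /bigcupP[B QB Bx] ->]; apply/bigcupP; exists B => //.
case/imsetP: (sQ B QB) Bx => y _ ->; rewrite orbitR !mem_lcoset => ?.
by rewrite mulgA groupM ?cycle_id.
Qed.

Lemma card_rcoset_fix (gT : finGroupType) (a : gT) (r : nat) :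
  #|[set A : {set gT} | (#|A| == r) && (A :* a == A)]| =
    if #[a] %| r then 'C(#|gT| %/ #[a], r %/ #[a]) else 0.
Proof.
have -> : [set A : {set gT} | (#|A| == r) && (A :* a == A)] =
    [set A in cover @: powerset (orbit 'R <[a]> @: [set: gT]) | #|A| == r].
  by apply/setP => A; rewrite -rcoset_fix_cover !inE andbC.
have partR : partition (orbit 'R <[a]> @: [set: gT]) [set: gT].
  by apply: orbit_partition; apply/actsP => x _ y; rewrite !inE.
have unifR : {in orbit 'R <[a]> @: [set: gT], forall B : {set gT}, #|B| = #[a]}.
  by move=> _ /imsetP[x _ ->]; rewrite orbitR card_lcoset.
rewrite (card_cover_draws _ _ partR unifR) ?order_gt0 //.
by rewrite -cardsT (card_uniform_partition unifR partR) mulnK.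
Qed.

(** A cyclic group has a unique subgroup of order [d], here [<[b]>], so the elements of order [d]
    are exactly its generators. *)
Lemma card_order_cycle (gT : finGroupType) (a : gT) (d : nat) :
  d %| #[a] -> #|[set x in <[a]> | #[x] == d]| = totient d.
Proof.
move=> dv; set b := a ^+ (#[a] %/ d).
have ob : #[b] = d by rewrite orderXdiv ?dvdn_div // divnA // mulKn.
rewrite -ob totient_gen ob; apply: eq_card => x; rewrite !inE.
apply/andP/eqP => [[xa /eqP ox]|gx].
  have := cycle_sub_group dv => /setP/(_ <[x]>%G).
  by rewrite !inE cycle_subG xa -orderE ox eqxx => /esym/eqP/(congr1 val).
have xb : x \in <[b]> by rewrite gx cycle_id.
by rewrite (subsetP (cycleX a _) x xb) /order -gx -ob.
Qed.

Lemma sum_order_cyclic (gT : finGroupType) (G : {group gT}) (F : nat -> nat) :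
  cyclic G ->
  (\sum_(x in G) F #[x] = \sum_(d <- divisors #|G|) totient d * F d)%N.
Proof.
move=> cycG; rewrite (sum_partition_seq (h := fun x => #[x]) _ (divisors_uniq #|G|)).
  have [a defG] := cyclicP cycG.
  apply: eq_big_seq => d; rewrite -dvdn_divisors // => dvd_d.
  rewrite -(@card_order_cycle _ a) ?orderE -?defG // -sum1_card big_distrl /=.
  by apply: eq_big => [x|x /andP[_ /eqP->]]; rewrite ?inE ?mul1n.
by move=> x Gx; rewrite -dvdn_divisors ?order_dvdG.
Qed.

(* ['I_p.+1] carries the additive group structure of Z/(p+1), written
   multiplicatively, so translates by [t] are right cosets [A :* inZp t]. *)
Lemma residues_shift (p : nat) (A : {set 'I_p.+1}) (t : nat) :
  residues p.+1 (shift (natset A) t) = A :* (inZp t : 'I_p.+1).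
Proof.
have modD (x : 'I_p.+1) : (x + t) %% p.+1 = (x * inZp t : 'I_p.+1)%g.
  by rewrite /= modnDmr.
apply/setP => y; rewrite inE; apply/imfsetP/rcosetP => /= [[b]|[x Ax ->]].
  case/imfsetP => _ /imfsetP[x /= Ax ->] -> ey.
  by exists x => //; apply: val_inj; rewrite /= ey modD.
exists (x + t)%N; last by rewrite -modD.
by apply/imfsetP; exists (nat_of_ord x) => //; apply/imfsetP; exists x.
Qed.

Lemma residues_natset (p : nat) (A : {set 'I_p.+1}) : residues p.+1 (natset A) = A.
Proof.
apply/setP => y; rewrite inE; apply/imfsetP/idP => /= [[_ /imfsetP[x /= Ax ->]]|Ay].
  by rewrite modn_small // => /val_inj ->.
by exists (nat_of_ord y); rewrite ?modn_small //; apply/imfsetP; exists y.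
Qed.

Lemma eqmod_shift (p : nat) (A B : {set 'I_p.+1}) (t : nat) :
  eqmod p.+1 (shift (natset A) t) (natset B) = (A :* (inZp t : 'I_p.+1) == B).
Proof. by rewrite /eqmod residues_shift residues_natset. Qed.

Lemma kequiv_orbit (p : nat) (A B : {set 'I_p.+1}) :
  kequiv A B = (B \in orbit 'Rs [set: 'I_p.+1] A).
Proof.
apply/existsP/imsetP => [[j]|[j _ ->]].
  by rewrite eqmod_shift => /eqP <-; exists (inZp j); rewrite ?inE //= rcosetE.
by exists j; rewrite eqmod_shift valZpK /= rcosetE.
Qed.

(** Places every period in the summation range of [total_classes]. *)
Lemma period_bounds (p : nat) (A : {set 'I_p.+1}) : 0 < period A <= p.+1.
Proof.
rewrite /period; case: ex_minnP => l /andP[-> _] minl /=.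
apply: minl; rewrite /eqmod residues_natset residues_shift /=.
(* Here [1] is the neutral element, that is, the residue 0. *)
suff -> : inZp p.+1 = 1 :> 'I_p.+1 by rewrite rcoset1.
by apply: val_inj; rewrite /= modnn.
Qed.

(** Translations commute, so [A] and [A :* x] are fixed by the same ones. *)
Lemma period_rcoset (p : nat) (A : {set 'I_p.+1}) (x : 'I_p.+1) :
  period (A :* x) = period A.
Proof.
apply: eq_ex_minn => l; congr (_ && _).
rewrite /eqmod !residues_natset !residues_shift.
by rewrite -rcosetM Zp_mulgC rcosetM (inj_eq (@rcoset_inj _ x)).
Qed.

Lemma acts_subsets_of_period (p n r : nat) :
  [acts [set: 'I_p.+1], on subsets_of_period n r p.+1 | 'Rs].
Proof.
apply/actsP => x _ A; rewrite !inE /= rcosetE.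
by rewrite period_rcoset card_rcoset.
Qed.

(** [equivalence_partition] keeps only the members of period [n] in each class; an orbit that starts
    there stays there, so nothing is cut off. *)
Lemma classes_of_period_orbit (p n r : nat) :
  classes_of_period n r p.+1 =
    orbit 'Rs [set: 'I_p.+1] @: subsets_of_period n r p.+1.
Proof.
apply: eq_in_imset => A SA; apply/setP => B; rewrite inE kequiv_orbit andbC.
apply: andb_idr => /imsetP[x Gx ->].
by rewrite (actsP (acts_subsets_of_period p n r)).
Qed.

Lemma total_classes_fix (p r : nat) :
  (total_classes r p.+1 * p.+1 =
   \sum_(a : 'I_p.+1) #|[set A : {set 'I_p.+1} | (#|A| == r) && (A :* a == A)]|)%N.
Proof.
rewrite /total_classes big_distrl /=.
under eq_bigr => n _.
  rewrite classes_of_period_orbit -[X in (_ * X)%N](card_ord p.+1) -cardsT.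
  (* Burnside's lemma, applied to each period separately. *)
  rewrite -(Frobenius_Cauchy (acts_subsets_of_period p n r)); over.
rewrite exchange_big /=; apply: eq_big => [a|a _]; first by rewrite inE.
set S := [set A | _]; rewrite -sum1_card.
(* For a fixed translation [a], the sets it fixes are sorted by period, to match the sum over
   [n]. *)
rewrite (sum_partition_seq (s := index_iota 1 p.+2) (h := @period _)) ?iota_uniq //.
2: by move=> A _; rewrite mem_index_iota ltnS period_bounds.
apply: eq_bigr => n _; rewrite -sum1_card; apply: eq_bigl => A.
by rewrite in_setI (sameP afix1P eqP) /= rcosetE !inE andbAC.
Qed.

Lemma big_divisors_gcd (m n : nat) (F : nat -> nat) :
    0 < m -> 0 < n ->
  (\sum_(d <- divisors m | d %| n) F d = \sum_(d <- divisors (gcdn m n)) F d)%N.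
Proof.
move=> m_gt0 n_gt0; rewrite -big_filter; apply: perm_big; apply: uniq_perm.
- by rewrite filter_uniq ?divisors_uniq.
- exact: divisors_uniq.
by move=> d; rewrite mem_filter -!dvdn_divisors ?gcdn_gt0 ?m_gt0 // dvdn_gcd andbC.
Qed.

Lemma total_classes_mul (p r : nat) : 0 < r ->
  (total_classes r p.+1 * p.+1 =
   \sum_(s <- divisors (gcdn p.+1 r)) 'C(p.+1 %/ s, r %/ s) * totient s)%N.
Proof.
move=> r_gt0; rewrite total_classes_fix.
(* The number of [r]-subsets fixed by a translation depends only on its order [d]; the zero values
   later reduce the divisors of [k] to those of the gcd. *)
pose F d := (if d %| r then 'C(p.+1 %/ d, r %/ d) else 0)%N.
have cycG : cyclic [set: 'I_p.+1] by rewrite Zp_cycle cycle_cyclic.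
transitivity (\sum_(a in [set: 'I_p.+1]) F #[a])%N.
  apply: eq_big => [a|a _]; first by rewrite inE.
  by rewrite /F -[X in (X %/ _)%N](card_ord p.+1) -card_rcoset_fix.
rewrite (sum_order_cyclic F cycG) cardsT card_ord -big_divisors_gcd // [RHS]big_mkcond.
by apply: eq_bigr => d _; rewrite /F; case: ifP; rewrite ?muln0 // mulnC.
Qed.

Local Open Scope ring_scope.

Theorem theorem2 (k r : nat) (hk : (2 <= k)%N) (hr1 : (1 <= r)%N)
    (hrk : (r <= k)%N) :
  (total_classes r k)%:R =
    1 / k%:R * \sum_(s <- divisors (gcdn k r))
                 ('C(k %/ s, r %/ s))%:R * (totient s)%:R :> rat.
Proof.
case: k hk {hrk} => // p _.
have k_neq0 : p.+1%:R != 0 :> rat by rewrite Num.Theory.pnatr_eq0.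
under eq_bigr do rewrite -GRing.natrM.
(* The sum is the cast of a natural number, [k] times the number of classes, and [k] cancels in
   [rat]. *)
rewrite -GRing.natr_sum -total_classes_mul // GRing.natrM GRing.mul1r.
by rewrite GRing.mulrCA GRing.mulVf // GRing.mulr1.
Qed.
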